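(* Let $N \ge 3$ and let $G$ be the path of length $N$, i.e. the graph with vertices $v_0,\dots,v_N$ in which $v_i$ and $v_j$ are joined by an edge if and only if $|i-j|=1$. Let $P_0$ be a non-degenerate Markovian weighting scheme without laziness on $G$, let $(P(t))_{t\ge 0}$ be the normalized curvature flow with $P(0)=P_0$, and assume that the limit $P^\infty=\lim_{t\to\infty}P(t)$ exists and that $(G,P^\infty)$ has no two-sided degenerate edges. Write $p^\infty_{i,j}$ for the transition rate of $P^\infty$ from $v_i$ to $v_j$. Then: (i) $(G,P^\infty)$ is neither totally degenerate nor non-degenerate; that is, it has at least one non-degenerate edge and at least one degenerate edge. (ii) The connected components of the non-degenerate subgraph $G_W$ of $(G,P^\infty)$ are paths of length $\le 2$, and they are separated from each other by at least two degenerate edges (that is, between any two distinct components of $G_W$ along the path $G$ there are at least two degenerate edges of $(G,P^\infty)$). (iii) If a component of $G_W$ is a path of length $1$, that is, consists of just one edge $\{v_j,v_{j+1}\}$, then $p^\infty_{j,j+1}=p^\infty_{j+1,j}=1$.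
   Context: The length of a path is its number of edges. Weighting schemes. Let $G=(V,E)$ be a finite simple connected undirected graph. A weighting scheme on $G$ is a matrix $P=(p_{xy})_{x,y\in V}$ with $p_{xy}\ge 0$, where $p_{xy}>0$ is only allowed if $x=y$ or $\{x,y\}\in E$. In general $P$ need not be symmetric. It is Markovian if $\sum_{y\in V}p_{xy}=1$ for all $x\in V$, and without laziness (non-lazy) if $p_{xx}=0$ for all $x\in V$. Degeneracy. An edge $\{x,y\}\in E$ of $(G,P)$ is non-degenerate if $p_{xy}>0$ and $p_{yx}>0$; otherwise it is degenerate. It is two-sided degenerate if $p_{xy}=p_{yx}=0$. The weighted graph $(G,P)$ is non-degenerate if all its edges are non-degenerate, and totally degenerate if it has no non-degenerate edge. The non-degenerate subgraph $G_W$ of $(G,P)$ is the subgraph of $G$ whose edges are all the non-degenerate edges of $(G,P)$ and whose vertex set $W$ consists of all the endpoints of these edges. Normalized curvature flow. Write $S_1(x)$ for the set of neighbours of $x$ in $G$. For a Markovian weighting scheme $P_0$ without laziness, the normalized curvature flow is the family $(P(t))_{t\ge 0}$ with $P(0)=P_0$, $p_{xx}(t)=0$ for all $x$, $p_{xy}(t)=0$ for distinct non-adjacent $x,y$, and, for all $x\in V$ and $y\in S_1(x)$, $$p_{xy}' = p_{xy}\Big(-4p_{yx}-2\sum_{y'\ne y}p_{yy'}+4\sum_{y'}p_{xy'}p_{y'x}+\sum_{y',y''}p_{xy'}p_{y'y''}\Big)+\sum_{y'\neq y}p_{xy'}p_{y'y},$$ where all rates are evaluated at time $t$ and $y',y''$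 range over $S_1(x)$. The solution exists and is unique for all $t\ge 0$, and each $P(t)$ is a Markovian weighting scheme without laziness. *)

(* Defs.v *)
From HB Require Import structures.
From mathcomp Require Import all_boot all_order all_algebra.
From mathcomp Require Import all_classical all_reals all_analysis.
Import Order.TTheory GRing.Theory Num.Theory.
Import numFieldNormedType.Exports.

Set Implicit Arguments.
Unset Strict Implicit.
Unset Printing Implicit Defensive.

Local Open Scope classical_set_scope.
Local Open Scope ring_scope.

(* Graphs have vertex type 'I_n and are given by their adjacency relation e;
   the rate p_xy of a weighting scheme is the matrix entry P x y. *)

Section WeightingSchemes.
Context (R : realType) (n : nat) (e : rel 'I_n).
Implicit Types (P : 'M[R]_n) (x y : 'I_n).

Definition weighting_scheme P : Prop :=
  (forall x y, 0 <= P x y) /\ (forall x y, 0 < P x y -> x = y \/ e x y).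

Definition markovian P : Prop := forall x, \sum_y P x y = 1.

Definition non_lazy P : Prop := forall x, P x x = 0.

Definition nondeg_edge P : rel 'I_n :=
  fun x y => [&& e x y, 0 < P x y & 0 < P y x].

Definition deg_edge P : rel 'I_n :=
  fun x y => e x y && ~~ ((0 < P x y) && (0 < P y x)).

Definition two_sided_deg_edge P : rel 'I_n :=
  fun x y => [&& e x y, P x y == 0 & P y x == 0].

Definition nondegenerate_scheme P : Prop := forall x y, e x y -> nondeg_edge P x y.

Definition totally_degenerate P : Prop := ~ exists x y, nondeg_edge P x y.

(* G_W has vertex set W = GW_vertices P and adjacency relation nondeg_edge P. *)
Definition GW_vertices P : {set 'I_n} :=
  [set x | [exists y, nondeg_edge P x y || nondeg_edge P y x]]%SET.

(* A component is represented by its vertex set; its edges are all the edges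
   of G_W between these vertices. *)
Definition GW_components P : {set {set 'I_n}} :=
  equivalence_partition (connect (nondeg_edge P)) (GW_vertices P).

(* Right-hand side of the normalized curvature flow at the edge (x, y).  All
   summation indices range over the neighbours of x, also in the sum of the
   rates P y y'. *)
Definition curvature_rhs P x y : R :=
  P x y * (- 4 * P y x
           - 2 * (\sum_(y' | e x y' && (y' != y)) P y y')
           + 4 * (\sum_(y' | e x y') P x y' * P y' x)
           + \sum_(y' | e x y') \sum_(y'' | e x y'') P x y' * P y' y'')
  + \sum_(y' | e x y' && (y' != y)) P x y' * P y' y.

(* P is only constrained on [0, +oo[; the derivative at 0 is one-sided. *)
Definition normalized_curvature_flow (P0 : 'M[R]_n) (P : R -> 'M[R]_n) : Prop :=
  [/\ P 0 = P0,
      forall (t : R) x, 0 <= t -> P t x x = 0,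
      forall (t : R) x y, 0 <= t -> x != y -> ~~ e x y -> P t x y = 0,
      forall (t : R) x y, 0 < t -> e x y ->
        is_derive t (1 : R) (fun s : R => P s x y) (curvature_rhs (P t) x y)
    & forall x y, e x y ->
        h^-1 * (P h x y - P 0 x y) @[h --> 0^'+] --> curvature_rhs (P 0) x y].

End WeightingSchemes.

(* The path of length l, with vertices v_i = i for i : 'I_l.+1. *)
Definition path_graph (l : nat) : rel 'I_l.+1 :=
  fun i j => (j == i.+1 :> nat) || (i == j.+1 :> nat).
Arguments path_graph : clear implicits.

(* The graph with vertex set C and adjacency relation r (restricted to C) is
   isomorphic to the path of length l. *)
Definition is_path_of_length (n : nat) (r : rel 'I_n) (C : {set 'I_n})
    (l : nat) : Prop :=
  exists f : 'I_l.+1 -> 'I_n,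
    [/\ injective f, [set f i | i in 'I_l.+1]%SET = C
      & forall i j, r (f i) (f j) = path_graph l i j].

(* For vertex sets C and D of the path of length N, with C entirely to the
   left of D: the edges {v_k, v_(k+1)} from the last vertex of C up to the
   first vertex of D. *)
Definition edge_from_to (N : nat) (C D : {set 'I_N.+1})
    (k : 'I_N.+1 * 'I_N.+1) : bool :=
  [&& k.2 == k.1.+1 :> nat,
      [forall c in C, (c <= k.1)%N] & [forall d in D, (k.2 <= d)%N]].

Definition deg_edges_between (R : realType) (N : nat) (P : 'M[R]_N.+1)
    (C D : {set 'I_N.+1}) : {set 'I_N.+1 * 'I_N.+1} :=
  [set k | deg_edge (path_graph N) P k.1 k.2
           && (edge_from_to C D k || edge_from_to D C k)]%SET.

(* Main.v *)
(* Neighbours of a common vertex of a path are not adjacent, so the flow reads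
   p_xy' = 4 p_xy (q_x - p_yx) with q_x = \sum_z p_xz p_zx.  Each p_xy, and each
   row sum minus 1, then solves a linear homogeneous equation, hence never
   changes sign: positivity and the Markov property persist.  The limit is
   stationary.  Write a_k for its rate from v_k to v_(k+1), so that v_(k+1) goes
   back to v_k with rate 1 - a_(k+1); then a_0 = 1, a_N = 0, and
   a_(k-1) + a_(k+1) = 1 wherever 0 < a_k < 1.  The edge {v_k, v_(k+1)} is
   non-degenerate iff 0 < a_k and a_(k+1) < 1.  A maximal chain of such edges
   starts with a_l = 1: otherwise a_(l-1) = 0 and a_l lies strictly between 0
   and 1, which forces a_(l+1) = 1.  If a_(l+1) is not 0, stationarity
   gives a_(l+2) = 1 - a_l = 0.  So a chain has one or two edges and ends
   with the value 0; two chains at distance one would be joined by a two-sided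
   degenerate edge. *)
Require Import Defs.
From HB Require Import structures.
From mathcomp Require Import all_boot all_order all_algebra.
From mathcomp Require Import all_classical all_reals all_analysis.
From mathcomp Require Import ring lra zify.
Import Order.TTheory GRing.Theory Num.Theory.
Import numFieldNormedType.Exports.

Local Open Scope classical_set_scope.
Local Open Scope ring_scope.

(** * Linear equations and limits of derivatives *)

(** On the compact interval [c] is bounded by some [K], so [u ^+ 2] grows and decays at most
    exponentially at rate [2 * K]; a zero at either end forces one at the other. *)
Lemma linear_ode_eq0 (R : realType) (u c : R -> R) (T : R) : 0 <= T ->
  {within `[0, T], continuous u} -> {within `[0, T], continuous c} ->
  (forall t, t \in `]0, T[ -> is_derive t 1 u (u t * c t)) ->
  (u 0 == 0) = (u T == 0).
Proof.
move=> T0 cu cc du.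
have [K cK] : exists K, forall t, t \in `]0, T[ -> `|c t| <= K.
  have [|x _ cx] := @EVT_max R (fun t => `|c t|) 0 T T0.
    by move=> x; apply: cvg_norm; exact: cc.
  by exists `|c x| => t tT; apply: cx; exact: subset_itv_oo_cc.
(* [v (2 * K)] is nondecreasing and [v (- 2 * K)] is nonincreasing. *)
pose v k t := u t ^+ 2 * expR (k * t).
have dv k t : t \in `]0, T[ ->
    is_derive t 1 (v k) (v k t * (2 * c t + k)).
  move=> /du dut.
  have du2 : is_derive t 1 (fun s => u s ^+ 2) (2 * u t * (u t * c t)).
    have -> : (fun s => u s ^+ 2) = u * u by apply/funext => s; rewrite expr2.
    by apply: is_derive_eq; rewrite /GRing.scale /=; ring.
  have de : is_derive t 1 (fun s => expR (k * s)) (k * expR (k * t)).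
    have -> : (fun s => expR (k * s)) = expR \o ( *%R k) by [].
    have dl : is_derive t 1 ( *%R k) (k * 1).
      exact: (@is_deriveZ _ _ _ id k t 1 1).
    by apply: is_derive_eq (is_derive1_comp _ dl) _; rewrite mulr1 mulrC.
  have -> : v k = (fun s => u s ^+ 2) * (fun s => expR (k * s)) by [].
  apply: is_derive_eq; rewrite /GRing.scale /v /= mulrfctE /=; ring.
have cv k : {within `[0, T], continuous (v k)}.
  move=> x; apply: cvgM; first by rewrite expr2; apply: cvgM; exact: cu.
  apply: (@continuous_subspaceT _ _ _ (fun s => expR (k * s))) => s.
  by apply: continuous_comp; [exact: mulrl_continuous | exact: continuous_expR].
have vv k t : 0 <= v k t by rewrite mulr_ge0 ?sqr_ge0 ?expR_ge0.
have v0 k : v k 0 = u 0 ^+ 2 by rewrite /v mulr0 expR0 mulr1.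
have vT k : (v k T == 0) = (u T == 0).
  by rewrite mulf_eq0 sqrf_eq0 [expR _ == 0]gt_eqF ?expR_gt0// orbF.
have mono k : (forall t, t \in `]0, T[ -> 0 <= 2 * c t + k) -> v k 0 <= v k T.
  move=> h; have [T00|/eqP Tn0] := eqVneq T 0; first by rewrite T00.
  have Tp : 0 < T by rewrite lt_def T0 andbT; apply/eqP.
  have [s sT e] := MVT Tp (dv k) (cv k).
  by rewrite -subr_ge0 e mulr_ge0 ?subr_ge0// mulr_ge0// h.
have anti k : (forall t, t \in `]0, T[ -> 2 * c t + k <= 0) -> v k T <= v k 0.
  move=> h; have [T00|/eqP Tn0] := eqVneq T 0; first by rewrite T00.
  have Tp : 0 < T by rewrite lt_def T0 andbT; apply/eqP.
  have [s sT e] := MVT Tp (dv k) (cv k).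
  by rewrite -subr_le0 e mulr_le0_ge0 ?subr_ge0// mulr_ge0_le0// h.
have H1 : v (2 * K) 0 <= v (2 * K) T.
  by apply: mono => t /cK; rewrite ler_norml => /andP[]; lra.
have H2 : v (- (2 * K)) T <= v (- (2 * K)) 0.
  by apply: anti => t /cK; rewrite ler_norml => /andP[]; lra.
(* A zero at 0 is carried forward by the nonincreasing function, a zero at [T] backward by the
   nondecreasing one. *)
apply/idP/idP => /eqP u0.
  rewrite -(vT (- (2 * K))); move: H2; rewrite v0 u0 expr0n /= => H2.
  by rewrite eq_le H2 vv.
move: H1; rewrite v0 /v u0 expr0n /= mul0r => H1.
by rewrite -sqrf_eq0 eq_le H1 sqr_ge0.
Qed.

(** By the mean value theorem [du] takes the value [u (t + 1) - u t] inside []t, t + 1[]; for large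
    [t] this is close to 0, as [u] converges, and also close to [L]. *)
Lemma cvg_derive_pinfty_eq0 (R : realType) (u du : R -> R) (l L : R) :
  (forall t : R, 0 < t -> is_derive t 1 u (du t)) ->
  u t @[t --> +oo] --> l -> du t @[t --> +oo] --> L -> L = 0.
Proof.
move=> hu ul duL; apply/eqP; rewrite -normr_le0; apply/ler_addgt0Pr => e e0.
(* One third each for [u t], [u (t + 1)] and [du] at the intermediate point. *)
have e4 : 0 < e / 3 by rewrite divr_gt0.
move/cvgrPdist_lt : ul => /(_ _ e4) [A [_ uA]].
move/cvgrPdist_lt : duL => /(_ _ e4) [B [_ duB]].
pose t := Num.max 0 (Num.max A B) + 1.
have tAB : [/\ 0 < t, A < t & B < t].
  have m1 : 0 <= Num.max 0 (Num.max A B) by rewrite le_max lexx.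
  have m2 : A <= Num.max 0 (Num.max A B) by rewrite !le_max lexx orbT.
  have m3 : B <= Num.max 0 (Num.max A B) by rewrite !le_max lexx !orbT.
  by rewrite /t; split; lra.
have [t0 tA tB] := tAB.
have tt : t < t + 1 by lra.
have du1 (x : R) : x \in `]t, t + 1[ -> is_derive x 1 u (du x).
  by rewrite in_itv /= => /andP[tx _]; apply: hu; exact: lt_trans tx.
have cu : {within `[t, t + 1], continuous u}.
  apply: derivable_within_continuous => x; rewrite in_itv /= => /andP[tx _].
  by have [] := hu x (lt_le_trans t0 tx).
have [c] := MVT tt du1 cu; rewrite in_itv /= => /andP[tc _].
have -> : t + 1 - t = 1 by ring.
rewrite mulr1 add0r => uc.
have := uA _ tA; have := uA _ (lt_trans tA tt); have := duB _ (lt_trans tB tc).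
rewrite -uc !ltr_norml ler_norml => /andP[? ?] /andP[? ?] /andP[? ?].
by apply/andP; split; lra.
Qed.

(** * The flow on triangle-free graphs and its limit *)

(** Rates between two neighbours of [x] vanish, also from a neighbour to itself (the case [v = w] of
    the first hypothesis), which removes three of the five terms. *)
Lemma curvature_rhs_triangle_free (R : realType) (n : nat) (e : rel 'I_n)
    (Q : 'M[R]_n) (x y : 'I_n) :
  (forall u v w, e u v -> e u w -> ~~ e v w) ->
  (forall u v, ~~ e u v -> Q u v = 0) -> e x y ->
  curvature_rhs e Q x y =
    Q x y * (4 * (\sum_(z | e x z) Q x z * Q z x - Q y x)).
Proof.
move=> tf Q0 xy; rewrite /curvature_rhs.
have nb z w : e x z -> e x w -> Q z w = 0 by move=> xz xw; exact/Q0/(tf x).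
rewrite [X in _ - 2 * X]big1 => [|z /andP[xz _]]; last exact: nb.
rewrite [X in _ + X]big1 => [|z /andP[xz _]]; last by rewrite (nb z y) ?mulr0.
rewrite [X in _ * (_ + X)]big1 => [|z xz]; last first.
  by rewrite big1 // => w xw; rewrite (nb z w) ?mulr0.
by ring.
Qed.

Section TriangleFreeFlow.
Context (R : realType) (n : nat) (e : rel 'I_n) (P0 : 'M[R]_n) (P : R -> 'M[R]_n).
Hypothesis e_sym : symmetric e.
Hypothesis triangle_free : forall x y z, e x y -> e x z -> ~~ e y z.
Hypothesis hflow : normalized_curvature_flow e P0 P.

Let q t x := \sum_(z | e x z) P t x z * P t z x.

Lemma flow_off_edge t x y : 0 <= t -> ~~ e x y -> P t x y = 0.
Proof.
case: hflow => _ Pdiag Poff _ _ t0.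
by have [<-|xy] := eqVneq x y => [_|]; [exact: Pdiag | exact: Poff].
Qed.

Lemma flow_is_derive (t : R) x y : 0 < t -> e x y ->
  is_derive t 1 (fun s => P s x y) (P t x y * (4 * (q t x - P t y x))).
Proof.
case: hflow => _ _ _ dP _ t0 xy.
rewrite -curvature_rhs_triangle_free //; first exact: dP.
by move=> u v; apply: flow_off_edge; exact: ltW.
Qed.

Lemma flow_within_continuous (T : R) x y : e x y ->
  {within `[0, T], continuous (fun t => P t x y)}.
Proof.
move=> xy; have [T0|T0] := ltP 0 T; last first.
  move: T0; rewrite le_eqVlt => /orP[/eqP ->|T0].
    by rewrite set_itv1; exact: continuous_subspace1.
  rewrite set_itv_ge ?bnd_simp -?ltNge//; exact: continuous_subspace0.
have cP t : 0 < t -> {for t, continuous (fun s => P s x y)}.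
  move=> t0; apply: differentiable_continuous; apply/derivable1_diffP.
  by have [] := @flow_is_derive t x y t0 xy.
apply/continuous_within_itvP => //; split.
- by move=> t; rewrite in_itv /= => /andP[t0 _]; exact: cP.
- case: hflow => _ _ _ _ /(_ x y xy) dP.
  have h0 : h @[h --> (0 : R)^'+] --> (0 : R).
    by apply: cvg_at_right_filter; exact: cvg_id.
  (* Right continuity at 0: [P h x y] is [P 0 x y] plus [h] times a difference quotient with a
     finite limit. *)
  have H : P 0 x y + h * (h^-1 * (P h x y - P 0 x y)) @[h --> 0^'+] --> P 0 x y.
    rewrite [X in _ --> X](_ : _ = P 0 x y + 0 * curvature_rhs e (P 0) x y).
      by apply: cvgD; [exact: cvg_cst | exact: cvgM h0 dP].
    by rewrite mul0r addr0.
  apply: cvg_trans H; apply: near_eq_cvg.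
  near=> h; have h_gt0 : 0 < h by near: h; exact: nbhs_right_gt.
  by rewrite /= mulrA mulfV ?gt_eqF// mul1r addrC subrK.
- by apply: cvg_at_left_filter; exact: cP.
Unshelve. all: by end_near. Qed.

(** A nonpositive value at [t] would give a zero at some time [c] by the intermediate value theorem;
    solving a linear homogeneous equation, the rate would then vanish at time 0 too. *)
Lemma flow_positive (t : R) x y : 0 <= t -> e x y -> 0 < P0 x y -> 0 < P t x y.
Proof.
move=> t0 xy P0xy; rewrite ltNge; apply/negP => Pt.
have E0 : P 0 = P0 by case: hflow.
have [|c cI Pc] := IVT t0 (@flow_within_continuous t x y xy) (v := 0).
  rewrite E0 le_max (ltW P0xy) andbT ge_min Pt orbT //.
move: cI; rewrite in_itv /= => /andP[c0 _].
suff : (P 0 x y == 0) = (P c x y == 0) by rewrite Pc E0 eqxx gt_eqF.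
apply: (@linear_ode_eq0 R (fun s => P s x y)
          (fun s => 4 * (q s x - P s y x)) c c0).
- exact: flow_within_continuous.
- move=> s; apply: cvgM; first exact: cvg_cst.
  apply: cvgB; last by apply: flow_within_continuous; rewrite e_sym.
  apply: cvg_big => [|z xz]; first exact: add_continuous.
  by apply: cvgM; apply: flow_within_continuous; rewrite // e_sym.
- by move=> s; rewrite in_itv /= => /andP[s0 _]; exact: flow_is_derive.
Qed.

(** Summing the equations of a row gives S' = 4 q (S - 1) for the row sum S, because the products
    [P t x y * P t y x] add up to [q t x]. Hence S - 1 stays 0. *)
Lemma flow_row_sum (t : R) x : 0 <= t ->
  \sum_(y | e x y) P0 x y = 1 -> \sum_(y | e x y) P t x y = 1.
Proof.
move=> t0 sP0; apply/eqP; rewrite -subr_eq0.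
have E0 : P 0 = P0 by case: hflow.
have cq : {within `[0, t], continuous (fun s => q s x)}.
  move=> s; apply: cvg_big => [|z xz]; first exact: add_continuous.
  by apply: cvgM; apply: flow_within_continuous; rewrite // e_sym.
suff <- : (\sum_(y | e x y) P 0 x y - 1 == 0) =
          (\sum_(y | e x y) P t x y - 1 == 0) by rewrite E0 sP0 subrr.
apply: (@linear_ode_eq0 R (fun s => \sum_(y | e x y) P s x y - 1)
          (fun s => 4 * q s x) t t0).
- move=> s; apply: cvgB; last exact: cvg_cst.
  apply: cvg_big => [|z xz]; first exact: add_continuous.
  exact: flow_within_continuous.
- by move=> s; apply: cvgM; [exact: cvg_cst | exact: cq].
move=> s; rewrite in_itv /= => /andP[s0 _].
have ds : is_derive s 1 (fun r => \sum_(y | e x y) P r x y)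
    (\sum_(y | e x y) P s x y * (4 * (q s x - P s y x))).
  have -> : (fun r => \sum_(y | e x y) P r x y) =
            \sum_(y | e x y) (fun r => P r x y).
    by apply/funext => r; rewrite fct_sumE.
  elim/big_ind2 : _ => [|f df g dg hf hg|y xy]; last exact: flow_is_derive.
    exact: is_derive_cst.
  exact: is_deriveD.
have d1 : is_derive s 1 (fun _ : R => (1 : R)) 0 by exact: is_derive_cst.
apply: is_derive_eq (is_deriveB ds d1) _.
rewrite (eq_bigr (fun y => P s x y * (4 * q s x) - 4 * (P s x y * P s y x)));
  last by move=> y _; ring.
by rewrite sumrB -mulr_suml -mulr_sumr -/(q s x); ring.
Qed.

Context (Pinf : 'M[R]_n).
Hypothesis hlim : P t @[t --> +oo] --> Pinf.

Let Pinf_entry x y : P t x y @[t --> +oo] --> Pinf x y.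
Proof.
exact: (@continuous_cvg _ _ _ _ _ P (fun M : 'M[R]_n => M x y) Pinf
         (@coord_continuous _ _ _ x y Pinf) hlim).
Qed.

Lemma flow_limit_off_edge x y : ~~ e x y -> Pinf x y = 0.
Proof.
move=> xy; have Pxy0 : P t x y @[t --> +oo] --> (0 : R).
  have H : (fun _ : R => (0 : R)) t @[t --> +oo] --> (0 : R) by exact: cvg_cst.
  apply: cvg_trans H; apply: near_eq_cvg; near=> t.
  by rewrite flow_off_edge.
exact: (cvg_unique _ (Pinf_entry x y) Pxy0).
Unshelve. all: by end_near. Qed.

Lemma flow_limit_ge0 x y : e x y -> 0 < P0 x y -> 0 <= Pinf x y.
Proof.
move=> xy P0xy; apply: (cvgr_to_ge (Pinf_entry x y)).
by near=> t; apply/ltW/flow_positive.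
Unshelve. all: by end_near. Qed.

Lemma flow_limit_row_sum x :
  \sum_(y | e x y) P0 x y = 1 -> \sum_(y | e x y) Pinf x y = 1.
Proof.
move=> sP0.
have H : \sum_(y | e x y) P t x y @[t --> +oo] --> \sum_(y | e x y) Pinf x y.
  by apply: cvg_big => [|z xz]; [exact: add_continuous | exact: Pinf_entry].
have H1 : \sum_(y | e x y) P t x y @[t --> +oo] --> (1 : R).
  have H1 : (fun _ : R => (1 : R)) t @[t --> +oo] --> (1 : R) by exact: cvg_cst.
  apply: cvg_trans H1; apply: near_eq_cvg; near=> t.
  by rewrite flow_row_sum.
exact: (cvg_unique _ H H1).
Unshelve. all: by end_near. Qed.

(** The right-hand side is polynomial in the rates, so the derivative of each rate converges as
    well, necessarily to 0; the factor 4 is then cancelled. *)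
Lemma flow_limit_stationary x y : e x y ->
  Pinf x y * (\sum_(z | e x z) Pinf x z * Pinf z x - Pinf y x) = 0.
Proof.
move=> xy.
have dP (t : R) : 0 < t -> is_derive t 1 (fun s => P s x y)
    (P t x y * (4 * (q t x - P t y x))) by move=> t0; exact: flow_is_derive.
have := cvg_derive_pinfty_eq0 _ _ _ _
  (Pinf x y * (4 * (\sum_(z | e x z) Pinf x z * Pinf z x - Pinf y x)))
  dP (Pinf_entry x y).
rewrite mulrCA => H; apply/eqP; rewrite -(mulrI_eq0 _ (@mulfI R 4 _)) //.
apply/eqP/H; rewrite mulrCA.
apply: cvgM; first exact: Pinf_entry.
apply: cvgM; first exact: cvg_cst.
apply: cvgB; last exact: Pinf_entry.
apply: cvg_big => [|z xz]; first exact: add_continuous.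
by apply: cvgM; exact: Pinf_entry.
Qed.

End TriangleFreeFlow.

(** * Combinatorics of stationary sequences of rates *)

Section Runs.
Context (R : realFieldType) (N : nat) (a : nat -> R).
Hypothesis a0 : a 0 = 1.
Hypothesis aN : a N = 0.
Hypothesis a_ge0 : forall k, 0 <= a k.
Hypothesis a_le1 : forall k, a k <= 1.
Hypothesis a_stationary : forall k, (0 < k < N)%N -> 0 < a k < 1 ->
  a k.-1 + a k.+1 = 1.

(* [k] stands for the edge {v_k, v_(k+1)}, non-degenerate iff [0 < a k] and
   [a k.+1 < 1]; a run lists the values on a component v_l, ..., v_r. *)
Definition run (l r : nat) : Prop :=
  [/\ (l < r <= N)%N, a l = 1, a r = 0
    & forall k, (l < k < r)%N -> 0 < a k < 1].

Lemma run_edge l r k : run l r -> (l <= k < r)%N -> 0 < a k /\ a k.+1 < 1.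
Proof.
move=> [/andP[lr rN] al ar inner] /andP[lk kr]; split.
  move: lk; rewrite leq_eqVlt => /orP[/eqP <-|lk]; first by rewrite al ltr01.
  by have /andP[] := inner k (introT andP (conj lk kr)).
move: kr; rewrite leq_eqVlt => /orP[/eqP ->|kr]; first by rewrite ar ltr01.
by have /andP[] := inner k.+1 (introT andP (conj (lk : (l < k.+1)%N) kr)).
Qed.

(** A run has the values 1 and 0 at its ends and only values strictly between them inside, so no end
    of one run lies inside another and no left end is a right end. *)
Lemma run_eq_or_disjoint l r l' r' : run l r -> run l' r' ->
  [\/ l = l' /\ r = r', (r < l')%N | (r' < l)%N].
Proof.
wlog ll : l r l' r' / (l <= l')%N.
  move=> H h h'; case/orP: (leq_total l l') => ll; first exact: H.
  by case: (H _ _ _ _ ll h' h) => [[-> ->]||]; [exact: Or31|exact: Or33|exact: Or32].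
move=> [/andP[lr rN] al ar inner] [/andP[lr' rN'] al' ar' inner'].
have [?|rl] := ltnP r l'; first by apply: Or32.
apply: Or31.
have E : l = l'.
  apply/eqP; rewrite eqn_leq ll leqNgt; apply/negP => lt_ll.
  move: rl; rewrite leq_eqVlt => /orP[/eqP E|rl].
    by move: al'; rewrite E ar => /esym/eqP; rewrite oner_eq0.
  by have /andP[_] := inner l' (introT andP (conj lt_ll rl)); rewrite al' ltxx.
split=> //; case: (ltngtP r r') => // rr.
  have := inner' r; rewrite -E lr rr ar ltxx => /(_ isT) //.
by have := inner r'; rewrite E lr' rr ar' ltxx => /(_ isT).
Qed.

(** Induction on [k]. Stationarity at [k] with [a k.+1 < 1] makes [a k.-1] positive. Were it below
    1, the induction hypothesis would put a 1 before it, and stationarity at [k.-1] would give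
    [a k = 0]. *)
Lemma edge_prev k : (k < N)%N -> 0 < a k -> a k.+1 < 1 -> a k < 1 ->
  (0 < k)%N /\ a k.-1 = 1.
Proof.
elim: k => [|k IH] kN ak ak1 ak_lt1; first by move: ak_lt1; rewrite a0 ltxx.
split=> //=.
have st := a_stationary k.+1 kN (introT andP (conj ak ak_lt1)).
rewrite /= in st.
apply/eqP; rewrite eq_le a_le1 leNgt; apply/negP => akp.
have akp0 : 0 < a k by lra.
have [k0 akk] := IH (ltnW kN) akp0 ak_lt1 akp.
have := a_stationary k _ (introT andP (conj akp0 akp)).
by rewrite k0 (ltnW kN) akk => /(_ isT); lra.
Qed.

Lemma edge_in_run k : (k < N)%N -> 0 < a k -> a k.+1 < 1 ->
  exists l r, [/\ run l r, (l <= k < r)%N & (r <= l.+2)%N].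
Proof.
move=> kN ak ak1; have [ak_lt1|ak_ge1] := ltP (a k) 1.
  (* The edge is the second of its run: the values are 1, [a k], 0, the last by stationarity at
     [k]. *)
  have [k0 akp] := edge_prev k kN ak ak1 ak_lt1.
  have kk : k.-1.+1 = k by rewrite prednK.
  exists k.-1, k.+1; rewrite kk; split=> //; last by rewrite leq_pred ltnSn.
  split=> //; first by rewrite kN andbT (leq_ltn_trans (leq_pred _)) ?ltnSn.
    have := a_stationary k _ (introT andP (conj ak ak_lt1)).
    by rewrite k0 kN akp => /(_ isT); lra.
  move=> j /andP[]; rewrite kk => kj jk.
  have -> : j = k by apply/eqP; rewrite eqn_leq kj andbT -ltnS.
  by rewrite ak ak_lt1.
have akE : a k = 1 by apply/eqP; rewrite eq_le a_le1 ak_ge1.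
have [ak1_gt0|ak1_le0] := ltP 0 (a k.+1); last first.
  (* The values are 1, 0: a run with a single edge. *)
  exists k, k.+1; split=> //; last by rewrite leqnn ltnSn.
  split=> //; first by rewrite ltnSn kN.
    by apply/eqP; rewrite eq_le ak1_le0 a_ge0.
  by move=> j /andP[kj jk]; move: (leq_trans kj jk); rewrite ltnn.
have kN1 : (k.+1 < N)%N.
  rewrite ltn_neqAle kN andbT; apply/eqP => kE.
  by move: ak1_gt0; rewrite kE aN ltxx.
(* The edge is the first of two: since [a k = 1], stationarity at [k.+1] gives [a k.+2 = 0]. *)
have st := a_stationary k.+1 kN1 (introT andP (conj ak1_gt0 ak1)).
rewrite /= in st.
exists k, k.+2; split=> //; last by rewrite leqnn ltnS leqnSn.
split=> //; first by rewrite ltnS leqnSn kN1.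
  by lra.
move=> j /andP[kj jk].
have -> : j = k.+1 by apply/eqP; rewrite eqn_leq kj andbT -ltnS.
by rewrite ak1_gt0 ak1.
Qed.

(** Take the first index with value below 1; it is not 0, and the edge just before it qualifies. *)
Lemma edge_exists : exists2 k, (k < N)%N & 0 < a k /\ a k.+1 < 1.
Proof.
have exk : exists k, a k < 1 by exists N; rewrite aN ltr01.
case: (ex_minnP exk) => [] [|k] ak1 kmin; first by move: ak1; rewrite a0 ltxx.
have ak : 1 <= a k by rewrite leNgt; apply/negP => /kmin; rewrite ltnn.
exists k; last by split=> //; exact: lt_le_trans ak.
by apply: kmin; rewrite aN ltr01.
Qed.

End Runs.

(** * Neighbours in a path *)

Lemma path_graph_sym N : symmetric (path_graph N).
Proof. by move=> x y; rewrite /path_graph orbC. Qed.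

Lemma path_graph_triangle_free N (x y z : 'I_N.+1) :
  path_graph N x y -> path_graph N x z -> ~~ path_graph N y z.
Proof.
rewrite /path_graph => /orP[]/eqP ? /orP[]/eqP ?; apply/negP => /orP[]/eqP ?; lia.
Qed.

(** The guards remove the neighbour missing at an end, where [inord x.+1] would be a default vertex
    and [inord x.-1] would be [x] itself. *)
Lemma path_graph_sum (V : nmodType) N (F : 'I_N.+1 -> V) (x : 'I_N.+1) :
  \sum_(y | path_graph N x y) F y =
  (if (x < N)%N then F (inord x.+1) else 0) +
  (if (0 < x)%N then F (inord x.-1) else 0).
Proof.
rewrite (bigID (fun y : 'I_N.+1 => y == x.+1 :> nat)) /=; congr (_ + _).
  case: ltnP => xN.
    rewrite (big_pred1 (inord x.+1)) // => y.
    rewrite /path_graph /= -val_eqE /= inordK //.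
    by case: eqP => //= _; rewrite andbF.
  rewrite big_pred0 // => y; apply/negP => /andP[_ /eqP yx].
  by have := ltn_ord y; rewrite yx ltnS ltnNge xN.
case: ltnP => x0.
  rewrite (big_pred1 (inord x.-1)) // => y.
  rewrite /path_graph /= -val_eqE /= inordK ?(leq_ltn_trans (leq_pred _))//.
  have := ltn_ord y; lia.
rewrite big_pred0 // => y; rewrite /path_graph; lia.
Qed.

(** * Stationary schemes on a path and the components of G_W *)

Section PathScheme.
Context (R : realType) (N : nat) (Q : 'M[R]_N.+1).
Hypothesis Q_ge0 : forall x y, path_graph N x y -> 0 <= Q x y.
Hypothesis Q_row_sum : forall x, \sum_(y | path_graph N x y) Q x y = 1.
Hypothesis Q_stationary : forall x y, path_graph N x y ->
  Q x y * (\sum_(z | path_graph N x z) Q x z * Q z x - Q y x) = 0.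
Hypothesis N_gt0 : (0 < N)%N.

(* The rate from v_k to v_(k+1), extended by 0 for k >= N. *)
Definition right_rate (k : nat) : R :=
  if (k < N)%N then Q (inord k) (inord k.+1) else 0.

Lemma right_rateE (x y : 'I_N.+1) : y = x.+1 :> nat -> Q x y = right_rate x.
Proof.
move=> yx; have xN : (x < N)%N by have := ltn_ord y; rewrite yx ltnS.
by rewrite /right_rate xN -yx !inord_val.
Qed.

(** The row of [y] has at most two entries, adding up to 1; at the right end [right_rate] is 0 and
    the rate back is 1. *)
Lemma left_rateE (x y : 'I_N.+1) : y = x.+1 :> nat -> Q y x = 1 - right_rate y.
Proof.
move=> yx; have := Q_row_sum y; rewrite path_graph_sum.
have -> : (0 < y)%N by rewrite yx.
have -> : inord y.-1 = x by rewrite yx inord_val.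
rewrite /right_rate inord_val /= => <-.
by rewrite addrAC subrr add0r.
Qed.

Lemma right_rate0 : right_rate 0 = 1.
Proof.
have := Q_row_sum (inord 0).
by rewrite path_graph_sum inordK // ltnn addr0 /right_rate N_gt0.
Qed.

Lemma right_rateN : right_rate N = 0.
Proof. by rewrite /right_rate ltnn. Qed.

Lemma right_rate_ge0 k : 0 <= right_rate k.
Proof.
rewrite /right_rate; case: ifP => // kN; apply: Q_ge0.
by rewrite /path_graph !inordK ?eqxx // ltnW.
Qed.

Lemma right_rate_le1 k : right_rate k <= 1.
Proof.
case: (posnP k) => [->|k0]; first by rewrite right_rate0.
have [kN|Nk] := leqP k N; last first.
  by rewrite /right_rate ltnNge (ltnW Nk) ler01.
pose x : 'I_N.+1 := inord k.-1; pose y : 'I_N.+1 := inord k.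
have yx : y = x.+1 :> nat by rewrite /x /y !inordK ?prednK //; lia.
have := Q_ge0 y x; rewrite left_rateE // subr_ge0 /y inordK //; apply.
by rewrite /path_graph -/y yx eqxx orbT.
Qed.

Lemma right_rate_stationary k : (0 < k < N)%N -> 0 < right_rate k < 1 ->
  right_rate k.-1 + right_rate k.+1 = 1.
Proof.
move=> /andP[k0 kN] /andP[ak0 ak1].
pose w : 'I_N.+1 := inord k.-1; pose x : 'I_N.+1 := inord k.
pose y : 'I_N.+1 := inord k.+1.
have xk : x = k :> nat by rewrite inordK // ltnW.
have yk : y = k.+1 :> nat by rewrite inordK.
have wk : w = k.-1 :> nat by rewrite inordK //; lia.
have xy : y = x.+1 :> nat by rewrite xk.
have wx : x = w.+1 :> nat by rewrite xk wk prednK.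
have exy : path_graph N x y by rewrite /path_graph xy eqxx.
have := Q_stationary x y exy; rewrite path_graph_sum xk kN k0 -/y -/w.
rewrite (right_rateE x y xy) (left_rateE x y xy).
rewrite (right_rateE w x wx) (left_rateE w x wx) xk yk wk.
move/eqP; rewrite mulf_eq0 gt_eqF //= => /eqP H.
(* Since q_x = a_k (1 - a_(k+1)) + (1 - a_k) a_(k-1), subtracting the rate 1 - a_(k+1) leaves a
   multiple of 1 - a_k. *)
have : (1 - right_rate k) * (right_rate k.-1 + right_rate k.+1 - 1) = 0.
  by rewrite -H; ring.
by move/eqP; rewrite mulf_eq0 subr_eq0 gt_eqF //= subr_eq0 => /eqP.
Qed.

Lemma nondeg_edge_succ (x y : 'I_N.+1) : y = x.+1 :> nat ->
  nondeg_edge (path_graph N) Q x y = (0 < right_rate x) && (right_rate y < 1).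
Proof.
move=> yx; rewrite /nondeg_edge (right_rateE x y yx) (left_rateE x y yx).
by rewrite subr_gt0 /path_graph yx eqxx.
Qed.

Lemma nondeg_edge_sym : symmetric (nondeg_edge (path_graph N) Q).
Proof.
by move=> x y; rewrite /nondeg_edge path_graph_sym; case: path_graph; rewrite //= andbC.
Qed.

Local Notation GW := (nondeg_edge (path_graph N) Q).

Lemma run_nondeg_edge l r (x y : 'I_N.+1) : run R N right_rate l r ->
  (l <= x <= r)%N -> (l <= y <= r)%N -> GW x y = path_graph N x y.
Proof.
move=> lr xlr ylr; apply/idP/idP => [/and3P[]//|].
wlog xy : x y xlr ylr / y = x.+1 :> nat.
  move=> H exy; case/orP: (exy) => /eqP xy; first exact: H.
  by rewrite nondeg_edge_sym; apply: H => //; rewrite path_graph_sym.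
move=> _; rewrite nondeg_edge_succ // xy.
by apply/andP; apply: run_edge lr _; lia.
Qed.

Lemma run_is_path_of_length l r (C : {set 'I_N.+1}) :
  run R N right_rate l r -> (forall x : 'I_N.+1, (x \in C) = (l <= x <= r)%N) ->
  is_path_of_length GW C (r - l).
Proof.
move=> lr inC; have [/andP[l_r rN] _ _ _] := lr.
pose f (i : 'I_(r - l).+1) : 'I_N.+1 := inord (l + i).
have fE i : f i = l + i :> nat.
  by rewrite /f inordK //; have := ltn_ord i; lia.
have f_lr i : (l <= f i <= r)%N by rewrite fE; have := ltn_ord i; lia.
exists f; split.
- move=> i j /(congr1 val) /=; rewrite !fE => /addnI; exact: val_inj.
- apply/setP => x; rewrite inC; apply/imsetP/idP => [[i _ ->]//|xlr].
  have xl : (x - l < (r - l).+1)%N by lia.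
  by exists (Ordinal xl) => //; apply: val_inj; rewrite /= fE /=; lia.
- move=> i j; rewrite (run_nondeg_edge l r) // /path_graph !fE -!addnS.
  by rewrite !eqn_add2l.
Qed.

(** Some edge at a vertex of [C] lies in a run. The run is connected in G_W and no edge of G_W
    leaves it, so it is the whole component. *)
Lemma GW_components_run C : C \in GW_components (path_graph N) Q ->
  exists l r : nat, [/\ run R N right_rate l r, (r <= l.+2)%N
    & forall x : 'I_N.+1, (x \in C) = (l <= x <= r)%N].
Proof.
case/imsetP => x; rewrite inE => /existsP[y]; rewrite [GW y x]nondeg_edge_sym orbb.
move=> GWxy ->.
have [k [kN [ak ak1] xk]] : exists k, [/\ (k < N)%N,
    0 < right_rate k /\ right_rate k.+1 < 1 & (k <= x <= k.+1)%N].
  have /and3P[/orP[]/eqP xy _ _] := GWxy.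
    exists x; rewrite -xy leqnn xy leqnSn; split=> //.
      by have := ltn_ord y; rewrite xy ltnS.
    by move: GWxy; rewrite nondeg_edge_succ // xy => /andP.
  exists y; rewrite -xy leqnn xy leqnSn; split=> //.
    by have := ltn_ord x; rewrite xy ltnS.
  by move: GWxy; rewrite nondeg_edge_sym nondeg_edge_succ // xy => /andP.
have [l [r [lr /andP[lk kr] rl2]]] := edge_in_run _ _ _ right_rate0 right_rateN
  right_rate_ge0 right_rate_le1 right_rate_stationary _ kN ak ak1.
exists l, r; split=> // z.
have xlr : (l <= x <= r)%N by lia.
have csym : connect_sym GW by apply: sym_connect_sym; exact: nondeg_edge_sym.
have [lrN al ar _] := lr.
have GWlr (u v : 'I_N.+1) : (l <= u < r)%N -> v = u.+1 :> nat -> GW u v.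
  move=> ulr vu; rewrite (run_nondeg_edge l r) //; try lia.
  by rewrite /path_graph vu eqxx.
have conn (u : 'I_N.+1) : (l <= u <= r)%N -> connect GW (inord l) u.
  have : exists m, u = m :> nat by exists u.
  case=> m; elim: m u => [|m IH] u um ulr.
    by rewrite (_ : inord l = u) //; apply/val_inj; rewrite /= inordK; lia.
  have [lu|ul] := ltnP l u; last first.
    by rewrite (_ : inord l = u) //; apply/val_inj; rewrite /= inordK; lia.
  have [u' u'm] : exists u' : 'I_N.+1, u' = m :> nat.
    by exists (inord m); rewrite inordK //; lia.
  apply: (connect_trans (IH u' u'm _)); first by lia.
  by apply: connect1; apply: GWlr; lia.
(* An edge leaving to the right would need [right_rate r] positive, one leaving to the left
   [right_rate l] below 1. *)
have clos : closed_mem GW (mem [pred u : 'I_N.+1 | (l <= u <= r)%N]).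
  apply: intro_closed => // u v GWuv; rewrite !inE => ulr.
  have /and3P[/orP[]/eqP uv _ _] := GWuv.
    have [//|ru] := ltnP u r; first by lia.
    move: GWuv; rewrite nondeg_edge_succ // (_ : u = r :> nat); last lia.
    by rewrite ar ltxx.
  have [//|lu] := ltnP l u; first by lia.
  move: GWuv; rewrite nondeg_edge_sym nondeg_edge_succ // (_ : u = l :> nat); last lia.
  by rewrite al ltxx andbF.
rewrite !inE; apply/andP/idP => [[_ xz]|zlr].
  by have := closed_connect clos xz; rewrite !inE xlr => <-.
split; last by apply: (connect_trans _ (conn z zlr)); rewrite csym; exact: conn.
(* Each vertex of the run lies in W, through its right neighbour or, at the end [r], its left
   one. *)
apply/existsP; have [zr|rz] := ltnP z r.
  by exists (inord z.+1); rewrite GWlr // ?inordK; lia.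
by exists (inord z.-1); rewrite orbC GWlr // ?inordK; lia.
Qed.

End PathScheme.

(** * Application to the limit of the flow *)

Theorem proposition2p5 (R : realType) (N : nat) (hN : (3 <= N)%N)
    (P0 : 'M[R]_N.+1) (P : R -> 'M[R]_N.+1) (Pinf : 'M[R]_N.+1)
    (hW : weighting_scheme (path_graph N) P0)
    (hM : markovian P0)
    (hL : non_lazy P0)
    (hP0 : nondegenerate_scheme (path_graph N) P0)
    (hflow : normalized_curvature_flow (path_graph N) P0 P)
    (hlim : P t @[t --> +oo] --> Pinf)
    (h2deg : ~ exists x y, two_sided_deg_edge (path_graph N) Pinf x y) :
  let comps := GW_components (path_graph N) Pinf in
  let GW := nondeg_edge (path_graph N) Pinf in
  [/\ [/\ ~ totally_degenerate (path_graph N) Pinf,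
          ~ nondegenerate_scheme (path_graph N) Pinf,
          exists x y, nondeg_edge (path_graph N) Pinf x y
        & exists x y, deg_edge (path_graph N) Pinf x y],
      (forall C, C \in comps ->
         exists2 l : nat, (l <= 2)%N & is_path_of_length GW C l) /\
      (forall C D, C \in comps -> D \in comps -> C <> D ->
         (2 <= #|deg_edges_between Pinf C D|)%N)
    & forall C, C \in comps -> is_path_of_length GW C 1 ->
        exists i j : 'I_N.+1,
          [/\ (j = i.+1 :> nat), C = [set i; j]%SET, Pinf i j = 1
            & Pinf j i = 1]].

Proof.
move=> comps GW.
have tf := @path_graph_triangle_free N.
have sy := @path_graph_sym N.
have [P0_ge0 P0_edge] := hW.
have P0_pos x y : path_graph N x y -> 0 < P0 x y by move=> /hP0 /and3P[].
have P0_sum x : \sum_(y | path_graph N x y) P0 x y = 1.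
  rewrite -(hM x) [RHS](bigID (path_graph N x)) /= [X in _ + X]big1 ?addr0 //.
  move=> y xy; apply/eqP; rewrite eq_le P0_ge0 andbT leNgt; apply/negP => P0xy.
  have [E|E] := P0_edge x y P0xy; last by rewrite E in xy.
  by move: P0xy; rewrite E hL ltxx.
have Q_ge0 x y (xy : path_graph N x y) : 0 <= Pinf x y :=
  flow_limit_ge0 _ _ _ _ _ sy tf hflow _ hlim x y xy (P0_pos x y xy).
have Q_sum x := flow_limit_row_sum _ _ _ _ _ sy tf hflow _ hlim x (P0_sum x).
have Q_st := flow_limit_stationary _ _ _ _ _ tf hflow _ hlim.
have N0 : (0 < N)%N by exact: leq_trans hN.
pose a := right_rate _ _ Pinf.
have a0 : a 0 = 1 := right_rate0 _ _ _ Q_sum N0.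
have aN : a N = 0 := right_rateN _ _ _.
have a_ge0 : forall k, 0 <= a k := right_rate_ge0 _ _ _ Q_ge0.
have a_le1 : forall k, a k <= 1 := right_rate_le1 _ _ _ Q_ge0 Q_sum N0.
have a_st := right_rate_stationary _ _ _ Q_sum Q_st N0.
have GWE := nondeg_edge_succ _ _ _ Q_sum.
have rateR := right_rateE _ _ Pinf.
have rateL := left_rateE _ _ _ Q_sum.
have comp_run := GW_components_run _ _ _ Q_ge0 Q_sum Q_st N0.
have degE (x y : 'I_N.+1) : y = x.+1 :> nat ->
    deg_edge (path_graph N) Pinf x y = (a x == 0) || (a y == 1).
  move=> xy; rewrite /deg_edge rateR // rateL // -!/a /path_graph xy eqxx /=.
  rewrite negb_and -!leNgt subr_le0 !eq_le a_ge0 a_le1 andbT.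
  by rewrite -xy.
have edge_of k : (k < N)%N -> exists x y : 'I_N.+1, x = k :> nat /\ y = k.+1 :> nat.
  by move=> kN; exists (inord k), (inord k.+1); rewrite !inordK // ltnW.
have exGW : exists x y, GW x y.
  have [k kN ak] := edge_exists _ _ _ a0 aN.
  have [x [y [xk yk]]] := edge_of k kN.
  by exists x, y; rewrite /GW GWE ?xk // -/a yk; apply/andP.
(* If [a 1 = 1], the edge {v_0, v_1} is degenerate. Otherwise it lies in a run starting at 0, which
   ends at [r <= 2 < N], and [a r = 0] makes the next edge degenerate. *)
have exdeg : exists x y, deg_edge (path_graph N) Pinf x y.
  have [a1|a1] := ltP (a 1) 1; last first.
    have [x [y [xk yk]]] := edge_of 0 N0.
    by exists x, y; rewrite degE xk // yk orbC eq_le a_le1 a1.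
  have a0_gt0 : 0 < a 0 by rewrite a0 ltr01.
  have [l [r [[lrN al ar _] lr0 rl2]]] :=
    edge_in_run _ _ _ a0 aN a_ge0 a_le1 a_st 0 N0 a0_gt0 a1.
  have rN : (r < N)%N by lia.
  have [x [y [xk yk]]] := edge_of r rN.
  by exists x, y; rewrite degE xk // ar eqxx.
(* If [l' = r.+1], both rates [a r] and [1 - a l'] vanish on the edge joining the runs, which is
   then two-sided degenerate. *)
have run_gap l r l' r' : run R N a l r -> run R N a l' r' -> (r < l')%N ->
    (r.+1 < l')%N.
  move=> [/andP[lr rN] _ ar _] [/andP[lr' rN'] al' _ _] rl.
  rewrite ltn_neqAle rl andbT; apply/eqP => E; apply: h2deg.
  have [|x [y [xk yk]]] := edge_of r; first by lia.
  exists x, y; rewrite /two_sided_deg_edge rateR ?rateL ?xk ?yk // -!/a.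
  by rewrite ar E al' subrr eqxx /path_graph xk yk eqxx.
have two_deg (C D : {set 'I_N.+1}) l r l' r' : run R N a l r -> run R N a l' r' ->
    (forall x : 'I_N.+1, (x \in C) = (l <= x <= r)%N) ->
    (forall x : 'I_N.+1, (x \in D) = (l' <= x <= r')%N) -> (r < l')%N ->
    (2 <= #|[set k | deg_edge (path_graph N) Pinf k.1 k.2
                     && edge_from_to C D k]%SET|)%N.
  move=> run1 run2 inC inD rl; have gap := run_gap _ _ _ _ run1 run2 rl.
  have [/andP[lr rN] _ ar _] := run1; have [/andP[lr' rN'] al' _ _] := run2.
  (* The two degenerate edges are the one leaving [r] and the one entering [l']; the gap makes them
     distinct. *)
  have [|x [y [xk yk]]] := edge_of r; first by lia.
  have [|z [w [zk wk]]] := edge_of l'.-1; first by lia.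
  have -> : 2%N = #|[set (x, y); (z, w)]%SET|.
    rewrite cards2; case: eqP => // -[xz _].
    by move: gap; rewrite -xk xz zk; lia.
  apply: subset_leq_card; apply/fintype.subsetP => k; rewrite !inE => /orP[]/eqP -> /=.
    rewrite degE ?xk // ar eqxx /=; apply/and3P; split => /=.
    - by rewrite xk yk.
    - by apply/forall_inP => c; rewrite inC xk => /andP[].
    - by apply/forall_inP => d; rewrite inD yk; lia.
  rewrite degE ?zk // wk prednK ?al' ?eqxx ?orbT /=; last by lia.
  apply/and3P; split => /=.
  - by rewrite zk wk.
  - by apply/forall_inP => c; rewrite inC zk; lia.
  - by apply/forall_inP => d; rewrite inD wk; lia.
split; first split=> //.
- by move=> nd; have [x [y /andP[xy /negP]]] := exdeg; have /and3P[_ -> ->] := nd x y xy.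
- split.
    move=> C /comp_run [l [r [lr rl2 inC]]]; exists (r - l)%N; first by lia.
    exact: run_is_path_of_length lr inC.
  move=> C D /comp_run [l [r [lr _ inC]]] /comp_run [l' [r' [lr' _ inD]]] CD.
  have [[El Er]|rl|rl] := run_eq_or_disjoint _ _ _ _ _ _ _ lr lr'.
  + by case: CD; apply/setP => x; rewrite inC inD El Er.
  + apply: (leq_trans (two_deg _ _ _ _ _ _ lr lr' inC inD rl)).
    apply: subset_leq_card; apply/fintype.subsetP => k; rewrite !inE.
    by move=> /andP[-> ->].
  + apply: (leq_trans (two_deg _ _ _ _ _ _ lr' lr inD inC rl)).
    apply: subset_leq_card; apply/fintype.subsetP => k; rewrite !inE.
    by move=> /andP[-> ->]; rewrite orbT.
- move=> C /comp_run [l [r [lr rl2 inC]]] [f [f_inj fC _]].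
  have [/andP[l_r rN] al ar _] := lr.
  have cardC : #|C| = 2%N by rewrite -fC card_imset // card_ord.
  have [|x [y [xk yk]]] := edge_of l; first by lia.
  (* A path of length 1 has two vertices, whereas a longer run would contain three. *)
  have rE : r = l.+1.
    apply/eqP; rewrite eqn_leq l_r andbT leqNgt; apply/negP => lr2.
    have [|y' [z [_ zk]]] := edge_of l.+1; first by lia.
    have : (#|[set x; y; z]%SET| <= #|C|)%N.
      apply: subset_leq_card; apply/fintype.subsetP => u; rewrite !inE inC.
      by move=> /orP[/orP[]|]/eqP ->; lia.
    by rewrite cardC finset.setUC cardsU1 cards2 !inE -!val_eqE /= xk yk zk; lia.
  exists x, y; rewrite rateR ?rateL ?xk ?yk //; split=> //.
    apply/setP => u; rewrite inC !inE -!val_eqE /= xk yk rE; lia.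
  by rewrite -rE ar subr0.
Qed.
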